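(* Let $\mathcal{F}$ be a saturated fusion system on a finite $2$-group $S$ such that for every $x\in S$ we have $\mathrm{Hom}_{\mathcal{F}}(\langle x\rangle, Z(S))\neq\emptyset$. Then $S$ is abelian.
   Context: Let $p$ be a prime and $S$ a finite $p$-group. For $P,Q\le S$, let $\mathrm{Hom}_S(P,Q)$ be the set of homomorphisms $P\to Q$ induced by conjugation by elements $g \in S$ which conjugate $P$ into $Q$, and $\mathrm{Inj}(P,Q)$ the set of injective group homomorphisms $P\to Q$. A fusion system $\mathcal{F}$ on (or over) $S$ is a category whose objects are all subgroups of $S$ and whose morphism sets $\mathrm{Hom}_{\mathcal{F}}(P,Q)$ (with composition being composition of maps) satisfy, for all $P,Q\le S$: (i) $\mathrm{Hom}_S(P,Q)\subseteq \mathrm{Hom}_{\mathcal{F}}(P,Q)\subseteq \mathrm{Inj}(P,Q)$; (ii) every $\varphi\in \mathrm{Hom}_{\mathcal{F}}(P,Q)$ is the composite of an isomorphism $P\to\varphi(P)$ in $\mathcal{F}$ followed by the inclusion $\varphi(P)\hookrightarrow Q$. Subgroups $P,Q\leq S$ are $\mathcal{F}$-conjugate if they are isomorphic in the category $\mathcal{F}$. Write $\mathrm{Aut}_{\mathcal{F}}(P)=\mathrm{Hom}_{\mathcal{F}}(P,P)$ and $\mathrm{Aut}_S(P)=\mathrm{Hom}_S(P,P)$. A subgroup $Q\le S$ is fully automized in $\mathcal{F}$ if $\mathrm{Aut}_S(Q)$ is a Sylow $p$-subgroup of $\mathrm{Aut}_{\mathcal{F}}(Q)$. It is receptive in $\mathcal{F}$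 if for every $P\le S$ and every isomorphism $\varphi:P\to Q$ in $\mathcal{F}$ there is a morphism $\hat\varphi\in\mathrm{Hom}_{\mathcal{F}}(N_\varphi,S)$ with $\hat\varphi|_P=\varphi$, where $N_\varphi=\{g\in N_S(P): \varphi\circ c_g\circ\varphi^{-1}\in \mathrm{Aut}_S(Q)\}$ and $c_g$ denotes the automorphism of $P$ induced by conjugation by $g$. The fusion system $\mathcal{F}$ is saturated if every subgroup of $S$ is $\mathcal{F}$-conjugate to a subgroup which is both fully automized and receptive in $\mathcal{F}$. $Z(S)$ denotes the center of $S$. *)

(* Defs.v *)
From mathcomp Require Import all_boot all_fingroup all_solvable.

Set Implicit Arguments.
Unset Strict Implicit.
Unset Printing Implicit Defensive.

Local Open Scope group_scope.

(* A map P -> Q between subgroups of gT is encoded as the finite function on  *)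
(* gT extending it by the value 1 outside P, so that Leibniz equality is      *)
(* equality of maps and sets of maps are finite sets.  The codomain is not    *)
(* recorded: a map and its corestrictions are the same finite function.       *)

Section Maps.

Variable gT : finGroupType.
Implicit Types (P Q R S : {group gT}) (f g : {ffun gT -> gT}).

Definition resmap P (h : gT -> gT) : {ffun gT -> gT} :=
  [ffun x => if x \in P then h x else 1].

(* The identity of P, and also its inclusion into any Q containing P. *)
Definition incl P := resmap P id.

Definition conjmap P (a : gT) := resmap P (fun x => x ^ a).

(* The value 1 outside the domain of f is preserved because g 1 = 1. *)
Definition compmap g f : {ffun gT -> gT} := [ffun x => g (f x)].

Definition Hom P Q : {set {ffun gT -> gT}} :=
  [set f in pffun_on 1 P Q | morphic P f].

Definition Inj P Q : {set {ffun gT -> gT}} :=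
  [set f in Hom P Q | dinjectiveb f P].

Definition HomS S P Q : {set {ffun gT -> gT}} :=
  [set conjmap P a | a in S & P :^ a \subset Q].

Definition cat_iso (H : {group gT} -> {group gT} -> {set {ffun gT -> gT}})
    P Q f f' : Prop :=
  [/\ f \in H P Q, f' \in H Q P, compmap f' f = incl P
    & compmap f f' = incl Q].

Lemma HomP P Q f :
  reflect [/\ {in P &, {morph f : x y / x * y}},
              forall x, x \in P -> f x \in Q
            & forall x, x \notin P -> f x = 1]
          (f \in Hom P Q).
Proof.
rewrite inE; apply: (iffP andP) => [[/pffun_onP[sf fQ] /morphicP fM] |].
  split=> // [x Px | x nPx]; first by apply: fQ; apply: image_f.
  apply/eqP; apply: contraNT nPx => nfx.
  by apply: (subsetP sf); rewrite inE.
case=> fM fQ f1; split; last exact/morphicP.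
apply/pffun_onP; split.
  by apply/subsetP=> x; rewrite inE; apply: contraNT => /f1->.
by move=> _ /imageP[x Px ->]; apply: fQ.
Qed.

Lemma img_group_set P Q f : f \in Inj P Q -> group_set (f @: P).
Proof.
rewrite inE => /andP[/HomP[fM _ _] _]; apply/group_setP; split.
  apply/imsetP; exists 1; rewrite ?group1 //.
  by apply: (mulgI (f 1)); rewrite -fM ?group1 // !mulg1.
move=> _ _ /imsetP[x Px ->] /imsetP[y Py ->].
by rewrite -fM // imset_f ?groupM.
Qed.

Definition img_group P Q f (fI : f \in Inj P Q) : {group gT} :=
  Group (img_group_set fI).

(* Objects of the category are exactly the subgroups of S: the hom-sets at    *)
(* any other pair of subgroups of gT are empty.                               *)
Record fusion_system S := FusionSystem {
  HomF :> {group gT} -> {group gT} -> {set {ffun gT -> gT}};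
  HomF_obj : forall P Q f, f \in HomF P Q -> P \subset S /\ Q \subset S;
  HomF_comp : forall P Q R f g,
    f \in HomF P Q -> g \in HomF Q R -> compmap g f \in HomF P R;
  HomF_conj : forall P Q,
    P \subset S -> Q \subset S -> HomS S P Q \subset HomF P Q;
  HomF_inj : forall P Q f, f \in HomF P Q -> f \in Inj P Q;
  HomF_factor : forall P Q f (fPQ : f \in HomF P Q),
    exists f0 f0',
      cat_iso HomF P (img_group (HomF_inj fPQ)) f0 f0'
      /\ f = compmap (incl (img_group (HomF_inj fPQ))) f0 }.

End Maps.

Section Saturation.

Variables (gT : finGroupType) (S : {group gT}) (F : fusion_system S).
Implicit Types (P Q R : {group gT}) (f g : {ffun gT -> gT}).

Definition F_conjugate P Q : Prop := exists f f', cat_iso F P Q f f'.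

(* Automorphism groups are rendered as subsets of the permutation group       *)
(* Aut P, whose elements fix every point outside P.                           *)
Definition AutF P : {set {perm gT}} := [set a in Aut P | resmap P a \in F P P].

Definition AutS P : {set {perm gT}} :=
  [set a in Aut P | resmap P a \in HomS S P P].

Definition fully_automized (p : nat) Q : Prop := p.-Sylow(AutF Q) (AutS Q).

(* N_f for an isomorphism f : P -> Q with inverse f'. *)
Definition Nset P Q f f' : {set gT} :=
  [set a in 'N_S(P) | compmap f (compmap (conjmap P a) f') \in HomS S Q Q].

Lemma Nset_group_set P Q f f' : cat_iso F P Q f f' -> group_set (Nset P Q f f').
Proof.
case=> Ff Ff' f'f ff'.
have /setIdP[/HomP[fM fQ f1] _] := HomF_inj Ff.
have /setIdP[/HomP[f'M f'P f'1] _] := HomF_inj Ff'.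
have fone : f 1 = 1.
  by apply: (mulgI (f 1)); rewrite -fM ?group1 // !mulg1.
have f'fE x : x \in P -> f' (f x) = x.
  by move=> Px; move/ffunP: f'f => /(_ x); rewrite !ffunE Px.
apply/group_setP; split.
  rewrite inE group1 /=; apply/imsetP; exists 1.
    by rewrite inE group1 conjsg1 subxx.
  apply/ffunP=> y; rewrite !ffunE; have [Qy | nQy] := boolP (y \in Q).
    rewrite f'P // !conjg1.
    by move/ffunP: ff' => /(_ y); rewrite !ffunE Qy.
  by rewrite f'1 // group1 conjg1 fone.
move=> a b /setIdP[Na /imsetP[c /setIdP[Sc sc] Ec]].
move=> /setIdP[Nb /imsetP[d /setIdP[Sd sd] Ed]].
rewrite inE groupM //=; apply/imsetP; exists (c * d).
  by rewrite inE groupM // conjsgM (subset_trans _ sd) // conjSg.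
apply/ffunP=> y; rewrite !ffunE.
have [Qy | nQy] := boolP (y \in Q); last first.
  by rewrite f'1 // group1 conj1g fone.
rewrite f'P // !conjgM.
have Pa : f' y ^ a \in P by rewrite memJ_norm ?f'P //; case/setIP: Na.
have Ey : f (f' y ^ a) = y ^ c.
  by move/ffunP: Ec => /(_ y); rewrite !ffunE Qy f'P.
have Qc : y ^ c \in Q by rewrite -Ey fQ.
move/ffunP: Ed => /(_ (y ^ c)); rewrite !ffunE Qc -Ey.
by rewrite f'fE // Pa.
Qed.

Definition Ngroup P Q f f' (fiso : cat_iso F P Q f f') : {group gT} :=
  Group (Nset_group_set fiso).

Definition receptive Q : Prop :=
  forall P f f' (fiso : cat_iso F P Q f f'),
    exists2 fhat, fhat \in F (Ngroup fiso) S & {in P, fhat =1 f}.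

Definition saturated (p : nat) : Prop :=
  forall P, P \subset S ->
    exists Q, [/\ Q \subset S, F_conjugate P Q, fully_automized p Q
                & receptive Q].

End Saturation.

(* Main.v *)
Require Import Defs.
From mathcomp Require Import all_boot all_fingroup all_solvable.
Set Implicit Arguments.
Unset Strict Implicit.
Unset Printing Implicit Defensive.

Local Open Scope group_scope.

(** Write [Z] for the center of [S] and [Y] for the group of squares of elements
    of [Z]. A morphism into a central subgroup always extends to the centraliser
    of its source ([central_extend]), so each [x] in [S] is sent into [Z] by a
    morphism defined on its whole centraliser in [S]. If that morphism extended
    further to an automorphism of [S], then [x] would be central, because
    automorphisms of [S] preserve [Z]. The theorem is therefore an extension
    problem.

    The prime 2 enters through [conj_inverse_eq]: no element of order at least 4
    is inverted by an element of [S]. Indeed the inversion would be transported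
    to an automorphism in F of a fully automized central cyclic subgroup, and
    the automorphisms in F of such a subgroup form a group of odd order. Consequently, if
    [v] is in the center of a subgroup [Q] and [t] normalises [Q] with [t ^+ 2]
    in [Q], then [t] inverts [[~ v, t]], which forces [t] to centralise [v ^+ 2]
    ([sqr_centralised]).

    This shows that everything conjugate to an element of [Y] is central
    ([Fconj_sqr_central]): a noncentral conjugate [w] with largest centraliser
    can be chosen so that its centraliser [Q] in [S] is receptive; receptivity
    then produces a square root of [w] in the center of [Q], so [w] commutes
    with an element of [S] outside its own centraliser. Since two conjugate
    central elements correspond under an automorphism of [S], even [Y] is closed
    under conjugacy. All squares of [S], being conjugate to squares of [Z], thus
    lie in [Y], and commutators are products of squares, so they lie in [Y] too.

    Finally, let [P] contain [Y]. Then [P] is normal in [S], and [S] acts on it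
    trivially on [Y] and on [P / Y]. The automorphisms in F of a subgroup [Q]
    above [Y] with these two properties form a normal 2-subgroup, hence all of
    them are induced by [S] if [Q] is fully automized
    ([stab_sqZ_sub_AutS]). So no obstruction to extending is left: every
    morphism defined on [P] extends to [S] ([sqZ_extend]). Centralisers contain
    [Y], and the extension problem is solved. *)

Lemma pgroup_of_elts (p : nat) (rT : finGroupType) (G : {group rT}) :
  (forall x, x \in G -> p.-elt x) -> p.-group G.
Proof.
move=> pG; apply/pgroupP=> q q_pr /(Cauchy q_pr)[x Gx ox].
by have /pgroupP := pG x Gx; apply=> //; rewrite -/#[x] ox.
Qed.

(** * Morphisms of a fusion system *)

Section FusionSystems.
Variables (gT : finGroupType) (S : {group gT}) (F : fusion_system S).
Implicit Types (P Q R : {group gT}) (f g h : {ffun gT -> gT}) (x y a : gT).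

Lemma F_morphism P Q f : f \in F P Q ->
  [/\ {in P &, {morph f : x y / x * y}}, {in P, forall x, f x \in Q},
      {in P &, injective f}, f 1 = 1
    & [/\ P \subset S, Q \subset S & forall x, x \notin P -> f x = 1]].
Proof.
move=> Ff; have [sP sQ] := HomF_obj Ff.
have /setIdP[/HomP[fM fQ f1] /dinjectiveP fI] := HomF_inj Ff.
by split=> //; apply: (mulgI (f 1)); rewrite -fM ?group1 // !mulg1.
Qed.

Lemma compmapE g f x : compmap g f x = g (f x).
Proof. exact: ffunE. Qed.

Lemma cat_isoP P Q f f' : cat_iso F P Q f f' ->
  [/\ f \in F P Q, f' \in F Q P, {in P, cancel f f'} & {in Q, cancel f' f}].
Proof.
case=> Ff Ff' f'f ff'; split=> // x Hx.
  by move/ffunP: f'f => /(_ x); rewrite !ffunE Hx.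
by move/ffunP: ff' => /(_ x); rewrite !ffunE Hx.
Qed.

Lemma F_conj P Q a : a \in S -> P \subset S -> Q \subset S ->
  P :^ a \subset Q -> conjmap P a \in F P Q.
Proof.
move=> Sa sP sQ sPaQ; apply: (subsetP (HomF_conj F sP sQ)).
by apply: imset_f; rewrite inE Sa.
Qed.

Lemma F_incl P Q : P \subset Q -> Q \subset S -> incl P \in F P Q.
Proof.
move=> sPQ sQ; have -> : incl P = conjmap P 1.
  by apply/ffunP=> x; rewrite !ffunE conjg1.
by rewrite F_conj ?conjsg1 // (subset_trans sPQ).
Qed.

Lemma F_restrict R P Q f : f \in F P Q -> R \subset P -> resmap R f \in F R Q.
Proof.
move=> Ff sRP; have [_ _ _ f1 [sP _ _]] := F_morphism Ff.
have -> : resmap R f = compmap f (incl R).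
  by apply/ffunP=> x; rewrite !ffunE; case: ifP => // _; rewrite f1.
exact: HomF_comp (F_incl sRP sP) Ff.
Qed.

Lemma F_image P Q f : f \in F P Q ->
  exists R : {group gT}, R = f @: P :> {set gT} /\
    exists f', cat_iso F P R f f'.
Proof.
move=> Ff; exists (img_group (HomF_inj Ff)); split=> //.
have [f0 [f0' [iso0 Ef]]] := HomF_factor Ff; exists f0'.
rewrite [X in cat_iso _ _ _ X _](_ : f = f0) //.
have [Ff0 _ _ _] := iso0; have [_ f0im _ f01 [_ _ out]] := F_morphism Ff0.
rewrite Ef; apply/ffunP=> x; rewrite !ffunE.
have [Px | nPx] := boolP (x \in P); first by rewrite f0im.
by rewrite out // if_same.
Qed.

Lemma F_corestrict P Q R f : f \in F P Q -> R \subset S ->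
  {in P, forall x, f x \in R} -> f \in F P R.
Proof.
move=> Ff sR fR; have [_ _ _ f1 [_ _ out]] := F_morphism Ff.
have [I [EI [f' /cat_isoP[FfI _ _ _]]]] := F_image Ff.
have sIR : I \subset R by rewrite EI; apply/subsetP=> _ /imsetP[x Px ->]; apply: fR.
suff -> : f = compmap (incl I) f by apply: HomF_comp FfI (F_incl sIR sR).
apply/ffunP=> x; rewrite !ffunE.
have [Px | nPx] := boolP (x \in P); first by rewrite EI imset_f.
by rewrite out // if_same.
Qed.

(** Morphisms are injective, so the cardinality bound makes [f] bijective, and
    the factorisation axiom then supplies the inverse. *)
Lemma F_iso P Q f : f \in F P Q -> #|Q| <= #|P| ->
  exists f', cat_iso F P Q f f'.
Proof.
move=> Ff leQP; have [_ fQ fI _ _] := F_morphism Ff.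
have [I [EI [f' iso]]] := F_image Ff; exists f'.
suff -> : Q = I by [].
apply/esym/val_inj/eqP; rewrite /= eqEcard EI card_in_imset // leQP andbT.
by apply/subsetP=> _ /imsetP[x Px ->]; apply: fQ.
Qed.

Lemma F_X P Q f x n : f \in F P Q -> x \in P -> f (x ^+ n) = f x ^+ n.
Proof.
move=> Ff Px; have [fM _ _ f1 _] := F_morphism Ff.
by elim: n => // n IHn; rewrite !expgS fM ?groupX // IHn.
Qed.

Lemma F_V P Q f x : f \in F P Q -> x \in P -> f x^-1 = (f x)^-1.
Proof.
move=> Ff Px; have [fM _ _ f1 _] := F_morphism Ff.
by apply/eqP; rewrite eq_sym eq_invg_mul -fM ?groupV // mulgV f1.
Qed.

Lemma F_J P Q f x a : f \in F P Q -> x \in P -> a \in P ->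
  f (x ^ a) = f x ^ f a.
Proof.
move=> Ff Px Pa; have [fM _ _ f1 _] := F_morphism Ff.
by rewrite !conjgE !fM ?groupM ?groupV // (F_V Ff).
Qed.

(** * Conjugacy of elements *)

(** Boolean, so that a conjugate with an extremal property can be selected. *)
Definition Fconj x y := [exists f in F <[x]> S, f x == y].

Lemma FconjP x y :
  reflect (exists P Q f, [/\ f \in F P Q, x \in P & f x = y]) (Fconj x y).
Proof.
apply: (iffP exists_inP) => [[f Ff /eqP Ex] | [P [Q [f [Ff Px Ex]]]]].
  by exists <[x]>%G, S, f; rewrite cycle_id.
have [_ fQ _ _ [sP sQ _]] := F_morphism Ff.
have sxP : <[x]> \subset P by rewrite cycle_subG.
exists (resmap <[x]> f); last by rewrite ffunE cycle_id Ex.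
apply: F_corestrict (F_restrict Ff sxP) _ _ => // u xu; rewrite ffunE xu.
by rewrite (subsetP sQ) ?fQ ?(subsetP sxP).
Qed.

Lemma Fconj_sym x y : Fconj x y -> Fconj y x.
Proof.
case/FconjP=> P [Q [f [Ff Px <-]]].
have [I [EI [f' /cat_isoP[FfI Ff' fK _]]]] := F_image Ff.
by apply/FconjP; exists I, P, f'; rewrite EI imset_f // fK.
Qed.

Lemma Fconj_trans x y z : Fconj x y -> Fconj y z -> Fconj x z.
Proof.
case/exists_inP=> f Ff /eqP Ex /exists_inP[g Fg /eqP Ey].
have [fM _ _ _ [sP _ _]] := F_morphism Ff.
have fy : {in <[x]>, forall u, f u \in <[y]>}.
  by move=> _ /cycleP[i ->]; rewrite (F_X _ Ff) ?cycle_id // Ex mem_cycle.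
have [_ _ _ _ [sy _ _]] := F_morphism Fg.
apply/exists_inP; exists (compmap g f).
  by apply: HomF_comp Fg; apply: F_corestrict Ff _ _.
by rewrite ffunE Ex Ey.
Qed.

(** * Automorphism groups *)

Lemma perm_of_F Q f : f \in F Q Q -> exists2 b, b \in AutF F Q & {in Q, b =1 f}.
Proof.
move=> Ff; have [fM fQ fI f1 [_ _ out]] := F_morphism Ff.
have fI1 : 'injm (Morphism fM) by apply/injmP.
have im : Morphism fM @* Q = Q.
  apply/eqP; rewrite eqEcard card_injm // leqnn andbT morphimEdom.
  by apply/subsetP=> _ /imsetP[x Qx ->]; apply: fQ.
exists (aut fI1 im); last by move=> x Qx; rewrite autE.
rewrite inE Aut_aut /=; suff -> : resmap Q (aut fI1 im) = f by [].
apply/ffunP=> x; rewrite ffunE; case: ifPn => [Qx | /out-> //].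
by rewrite autE.
Qed.

Lemma AutFP Q b : b \in AutF F Q ->
  [/\ b \in Aut Q, resmap Q b \in F Q Q & {in Q, forall x, b x \in Q}].
Proof. by case/setIdP=> Ab Fb; split=> // x; apply: Aut_closed. Qed.

Lemma AutF_group_set Q : Q \subset S -> group_set (AutF F Q).
Proof.
move=> sQ; apply/group_setP; split.
  rewrite inE group1 /=.
  have -> : resmap Q (1 : {perm gT}) = incl Q.
    by apply/ffunP=> x; rewrite !ffunE perm1.
  exact: F_incl.
move=> a b /AutFP[Aa Fa aQ] /AutFP[Ab Fb _]; rewrite inE groupM //=.
have -> : resmap Q (a * b) = compmap (resmap Q b) (resmap Q a).
  apply/ffunP=> x; rewrite !ffunE permM.
  by case: ifP => Qx; rewrite ?aQ // group1 -(autmE Ab) morph1.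
exact: HomF_comp Fa Fb.
Qed.
Definition AutF_group Q (sQ : Q \subset S) := Group (AutF_group_set sQ).

Lemma AutSP Q b :
  reflect (b \in Aut Q /\ exists c, [/\ c \in S, c \in 'N(Q)
             & {in Q, forall x, b x = x ^ c}])
          (b \in AutS S Q).
Proof.
apply: (iffP setIdP) => [] [Ab]; last first.
  case=> c [Sc Nc Eb]; split=> //; apply/imsetP; exists c.
    by rewrite inE Sc (normP Nc) /=.
  by apply/ffunP=> x; rewrite !ffunE; case: ifP => // /Eb.
case/imsetP=> c /setIdP[Sc sQc] Eb; split=> //; exists c; split=> //.
  by rewrite inE.
by move=> x Qx; move/ffunP: Eb => /(_ x); rewrite !ffunE Qx.
Qed.

Lemma AutS_group_set Q : group_set (AutS S Q).
Proof.
apply/group_setP; split.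
  apply/AutSP; rewrite group1; split=> //; exists 1; rewrite !group1.
  by split=> // x _; rewrite perm1 conjg1.
move=> a b /AutSP[Aa [c [Sc Nc Ea]]] /AutSP[Ab [d [Sd Nd Eb]]].
apply/AutSP; rewrite groupM //; split=> //; exists (c * d); rewrite !groupM //.
by split=> // x Qx; rewrite permM Ea // Eb ?memJ_norm // conjgM.
Qed.
Canonical AutS_group Q := Group (AutS_group_set Q).

(** * Extending morphisms *)

(** Receptivity with the extension control subgroup hidden behind the only
    property that is used: it contains each [a] whose action on [P] becomes, via
    [f], the action of some [c] in [S] on [Q]. *)
Lemma receptive_extend P Q f : receptive F Q -> f \in F P Q -> #|Q| <= #|P| ->
  exists (N : {group gT}) (g : {ffun gT -> gT}),
    [/\ g \in F N S, {in P, g =1 f}, P \subset N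
      & forall a c, a \in 'N_S(P) -> c \in S ->
          {in P, forall x, f (x ^ a) = f x ^ c} -> a \in N].
Proof.
move=> recQ Ff leQP; have [f' iso] := F_iso Ff leQP.
have [g Fg Eg] := recQ _ _ _ iso; exists (Ngroup iso), g.
have [_ Ff' fK f'K] := cat_isoP iso.
have [_ fQ _ f1 [sP sQ _]] := F_morphism Ff.
have [_ f'P _ _ [_ _ f'out]] := F_morphism Ff'.
have crit a c : a \in 'N_S(P) -> c \in S ->
  {in P, forall x, f (x ^ a) = f x ^ c} -> a \in Ngroup iso.
  move=> Na Sc Ec; rewrite inE Na; apply/imsetP; exists c.
    rewrite inE Sc; apply/subsetP=> _ /imsetP[y Qy ->].
    rewrite -(f'K y) // -Ec ?f'P // fQ // memJ_norm ?f'P //.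
    by case/setIP: Na.
  apply/ffunP=> y; rewrite !ffunE; have [Qy | nQy] := boolP (y \in Q).
    by rewrite f'P // Ec ?f'P // f'K.
  by rewrite f'out // group1 conj1g f1.
split=> //; apply/subsetP=> a Pa; apply: (crit a (f a)).
- by rewrite inE (subsetP sP) // (subsetP (normG P)).
- by rewrite (subsetP sQ) ?fQ.
by move=> x Px; rewrite (F_J Ff).
Qed.

(** Only morphisms onto receptive subgroups extend directly. For any other [f],
    compose with an isomorphism [r] onto a receptive subgroup; when [r] extends
    to an automorphism [s] of [S], an extension of the composite can be pulled
    back along [s]. *)
Lemma extend_back P Q N f g r s :
  f \in F P Q -> r \in F Q S -> s \in F S S -> {in Q, s =1 r} ->
  g \in F N S -> {in P, forall x, g x = r (f x)} ->
  exists2 h, h \in F N S & {in P, h =1 f}.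
Proof.
move=> Ff Fr Fs Es Fg Eg.
have [s' /cat_isoP[_ Fs' sK _]] := F_iso Fs (leqnn _).
exists (compmap s' g); first exact: HomF_comp Fg Fs'.
have [_ fQ _ _ [_ sQ _]] := F_morphism Ff.
by move=> x Px; rewrite ffunE Eg // -Es ?fQ // sK // (subsetP sQ) ?fQ.
Qed.

Section Saturated.
Variable p : nat.
Hypotheses (pS : p.-group S) (sat : saturated F p).

Lemma saturatedP P : P \subset S ->
  exists Q r, [/\ r \in F P Q, #|Q| = #|P|, fully_automized F p Q
                & receptive F Q].
Proof.
move=> sP; have [Q [sQ [r [r' /cat_isoP[Fr Fr' _ _]]] fa rec]] := sat sP.
exists Q, r; split=> //; apply/eqP; rewrite eqn_leq.
have card_le P1 Q1 h : h \in F P1 Q1 -> #|P1| <= #|Q1|.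
  move=> Fh; have [_ hQ hI _ _] := F_morphism Fh.
  rewrite -(card_in_imset hI) subset_leq_card //.
  by apply/subsetP=> _ /imsetP[x Px ->]; apply: hQ.
by rewrite (card_le _ _ r') // (card_le _ _ r).
Qed.

Lemma receptive_extend_central P Q f :
  receptive F Q -> f \in F P Q -> #|Q| <= #|P| -> P \subset 'Z(S) ->
  exists2 g, g \in F S S & {in P, g =1 f}.
Proof.
move=> rec Ff le sPZ; have [_ _ _ _ [sP _ _]] := F_morphism Ff.
have [N [g [Fg Eg _ Ng]]] := receptive_extend rec Ff le.
have cP x a : x \in P -> a \in S -> x ^ a = x.
  move=> /(subsetP sPZ)/centerP[_ cx] Sa; rewrite conjgE cx //.
  by rewrite mulKg.
exists (resmap S g); last first.
  by move=> x Px; rewrite ffunE (subsetP sP) // Eg.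
apply: F_restrict Fg _; apply/subsetP=> a Sa.
apply: (Ng a 1) => //; last by move=> x Px; rewrite cP // conjg1.
rewrite inE Sa inE; apply/subsetP=> _ /imsetP[x Px ->].
by rewrite cP.
Qed.

(** The image [I] of [P] is central, so an isomorphism from [I] onto a receptive
    [Q] extends to all of [S]. Its composite with [f] extends to the centraliser
    of [P], whose elements act trivially on [P] and so correspond to [1] on [Q];
    pulling back by the extension to [S] gives the result. *)
Lemma central_extend P f : f \in F P S -> {in P, forall x, f x \in 'Z(S)} ->
  exists2 g, g \in F 'C_S(P) S & {in P, g =1 f}.
Proof.
move=> Ff fZ; have [fM _ fI _ [sP _ _]] := F_morphism Ff.
have abP : abelian P.
  apply/centsP=> x Px y Py; apply: fI; rewrite ?groupM // !fM //.
  by have /centerP[_ ->] := fZ x Px; last by have /centerP[] := fZ y Py.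
have [I [EI [f' iso]]] := F_image Ff.
have [FfI _ _ _] := cat_isoP iso.
have [_ _ _ _ [_ sI _]] := F_morphism FfI.
have [Q [r [Fr cQ _ rec]]] := saturatedP sI.
have sIZ : I \subset 'Z(S).
  by rewrite EI; apply/subsetP=> _ /imsetP[x Px ->]; apply: fZ.
have [_ rQ _ _ [_ sQ _]] := F_morphism Fr.
have [s Fs Es] := receptive_extend_central rec Fr (eq_leq cQ) sIZ.
have FrS : r \in F I S.
  by apply: F_corestrict Fr _ _ => // x Ix; rewrite (subsetP sQ) ?rQ.
have cI : #|I| = #|P| by rewrite EI card_in_imset.
have Frf := HomF_comp FfI Fr.
have leQP : #|Q| <= #|P| by rewrite cQ cI.
have [N [g [Fg Eg _ Ng]]] := receptive_extend rec Frf leQP.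
have sCN : 'C_S(P) \subset N.
  apply/subsetP=> a Ca; apply: (Ng a 1) => //.
    by apply: (subsetP _ _ Ca); rewrite setIS ?cent_sub.
  case/setIP: Ca => _ /centP ca x Px; rewrite conjg1 /conjg.
  by rewrite -ca // mulKg.
apply: (@extend_back P I 'C_S(P)%G f (resmap 'C_S(P) g) r s) => //.
  exact: F_restrict Fg sCN.
by move=> x Px; rewrite ffunE inE (subsetP sP) // (subsetP abP) //= Eg // ffunE.
Qed.

(** The conjugate by [f] of Aut_S(P). Whether it lies in Aut_S(Q) decides whether
    [f] extends to the normaliser of [P], for a receptive [Q]. *)
Definition transported_AutS P Q f : {set {perm gT}} :=
  [set b in AutF F Q |
     [exists a in 'N_S(P), [forall x in P, f (x ^ a) == b (f x)]]].

Lemma transported_AutSP P Q f b :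
  reflect (b \in AutF F Q /\ exists2 a, a \in 'N_S(P)
            & {in P, forall x, f (x ^ a) = b (f x)})
          (b \in transported_AutS P Q f).
Proof.
apply: (iffP setIdP) => [] [Ab].
  by case/exists_inP=> a Na /forall_inP Ea; split=> //; exists a => // x /Ea/eqP.
case=> a Na Ea; split=> //; apply/exists_inP; exists a => //.
by apply/forall_inP=> x /Ea/eqP.
Qed.

Lemma transported_AutS_group_set P Q f :
  f \in F P Q -> group_set (transported_AutS P Q f).
Proof.
move=> Ff; have [_ fQ _ _ [_ sQ _]] := F_morphism Ff.
pose A := AutF_group sQ; apply/group_setP; split.
  apply/transported_AutSP; split; first exact: (group1 A).
  by exists 1 => // x _; rewrite conjg1 perm1.
move=> b d /transported_AutSP[Ab [a Na Ea]] /transported_AutSP[Ad [c Nc Ec]].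
apply/transported_AutSP; split; first exact: (@groupM _ A).
exists (a * c) => [|x Px]; first by rewrite groupM.
rewrite conjgM permM -Ea // Ec // memJ_norm //; by case/setIP: Na.
Qed.

Lemma transported_AutS_pgroup P Q f (Ff : f \in F P Q) : #|Q| <= #|P| ->
  p.-group (Group (transported_AutS_group_set Ff)).
Proof.
move=> leQP; apply: pgroup_of_elts => b /transported_AutSP[/AutFP[Ab _ bQ] [a Na Ea]].
have [f' /cat_isoP[_ Ff' _ f'K]] := F_iso Ff leQP.
have [_ f'P _ _ _] := F_morphism Ff'.
have EaX n : {in P, forall x, f (x ^ (a ^+ n)) = (b ^+ n) (f x)}.
  elim: n => [|n IHn] x Px; first by rewrite conjg1 perm1.
  rewrite !expgSr conjgM permM -IHn // Ea // memJ_norm // groupX //.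
  by case/setIP: Na.
apply: (@pnat_dvd _ #[a]); last first.
  by apply: (mem_p_elt pS); case/setIP: Na.
rewrite order_dvdn; apply/eqP/permP=> y; rewrite perm1.
have [Qy | nQy] := boolP (y \in Q).
  by rewrite -(f'K y) // -EaX ?f'P // expg_order conjg1.
by rewrite (out_Aut (groupX _ Ab)).
Qed.

Lemma extend_normalizer P Q f :
  receptive F Q -> f \in F P Q -> #|Q| <= #|P| ->
  transported_AutS P Q f \subset AutS S Q ->
  exists2 g, g \in F 'N_S(P) S & {in P, g =1 f}.
Proof.
move=> rec Ff leQP sL; have [N [g [Fg Eg _ Ng]]] := receptive_extend rec Ff leQP.
have [fM fQ fI _ [sP sQ _]] := F_morphism Ff.
have [f' /cat_isoP[_ Ff' fK f'K]] := F_iso Ff leQP.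
have [_ f'P _ _ _] := F_morphism Ff'.
exists (resmap 'N_S(P) g); last first.
  by move=> x Px; rewrite ffunE inE (subsetP sP) // (subsetP (normG P)) //= Eg.
apply: F_restrict Fg _; apply/subsetP=> a Na.
have [Sa NPa] := setIP Na.
have Fa : conjmap P a \in F P P by rewrite F_conj ?(normP NPa).
have [b Ab Eb] := perm_of_F (HomF_comp (HomF_comp Ff' Fa) Ff).
have Eab : {in P, forall x, f (x ^ a) = b (f x)}.
  by move=> x Px; rewrite Eb ?fQ // !ffunE fK // Px.
have /(subsetP sL)/AutSP[_ [c [Sc _ Ec]]] : b \in transported_AutS P Q f.
  by apply/transported_AutSP; split=> //; exists a.
by apply: (Ng a c) => // x Px; rewrite Eab // Ec ?fQ.
Qed.

(** By Sylow's theorem an isomorphism onto a fully automized subgroup can be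
    corrected by an automorphism so that it carries Aut_S(P) into Aut_S(Q). *)
Lemma fully_normalized P : P \subset S ->
  exists Q g, [/\ receptive F Q, #|Q| = #|P|, g \in F 'N_S(P) S
                & g @: P = Q].
Proof.
move=> sP; have [Q [r [Fr cQ fa rec]]] := saturatedP sP.
have [_ rQ rI _ [_ sQ _]] := F_morphism Fr.
pose L := Group (transported_AutS_group_set Fr); pose A := AutF_group sQ.
have sLA : L \subset A by apply/subsetP=> b /transported_AutSP[].
have pL : p.-group L by apply: transported_AutS_pgroup; rewrite cQ.
have [b Ab sLb] := Sylow_subJ (fa : p.-Sylow(A) (AutS_group Q)) sLA pL.
have /AutFP[Abi Fbi bQi] : b^-1 \in AutF F Q by apply: (@groupVr _ A).
have Fh := HomF_comp Fr Fbi.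
have sLA' : transported_AutS P Q (compmap (resmap Q b^-1) r) \subset AutS S Q.
  apply/subsetP=> d /transported_AutSP[Ad [a Na Ea]].
  suff Lbd : d ^ b \in L.
    by have := subsetP sLb _ Lbd; rewrite memJ_conjg.
  apply/transported_AutSP; split; first exact: (@groupJ _ A).
  exists a => // x Px; have := Ea x Px; rewrite !ffunE.
  have Pxa : x ^ a \in P by rewrite memJ_norm //; case/setIP: Na.
  rewrite !rQ //= => /(congr1 b); rewrite permKV => ->.
  by rewrite conjgE !permM.
have [|g Fg Eg] := extend_normalizer rec Fh _ sLA'; first by rewrite cQ.
have [_ hQ hI _ _] := F_morphism Fh.
exists Q, g; split=> //; apply/eqP; rewrite eqEcard.
rewrite (eq_in_imset Eg) (card_in_imset hI) cQ leqnn andbT.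
by apply/subsetP=> _ /imsetP[x Px ->]; apply: hQ.
Qed.

End Saturated.

(** * Conjugates of central elements *)

Lemma F_center s z : s \in F S S -> z \in 'Z(S) -> s z \in 'Z(S).
Proof.
move=> Fs /centerP[Sz cz]; have [s' /cat_isoP[_ Fs' _ s'K]] := F_iso Fs (leqnn _).
have [sM sS _ _ _] := F_morphism Fs; have [_ s'S _ _ _] := F_morphism Fs'.
apply/centerP; split; first exact: sS.
move=> y Sy; rewrite -(s'K y) // /commute -!sM ?s'S // cz //; exact: s'S.
Qed.

Lemma Fconj_in x y : Fconj x y -> x \in S.
Proof.
by case/FconjP=> P [Q [f [Ff Px _]]]; have [sP _] := HomF_obj Ff; apply: (subsetP sP).
Qed.

Lemma Fconj_extend p x z : saturated F p -> Fconj x z -> z \in 'Z(S) ->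
  exists2 g, g \in F 'C_S[x] S & g x = z.
Proof.
move=> sat /exists_inP[f Ff /eqP Ex] Zz.
have fZ : {in <[x]>, forall u, f u \in 'Z(S)}.
  by move=> _ /cycleP[i ->]; rewrite (F_X _ Ff) ?cycle_id // Ex groupX.
have [g Fg Eg] := central_extend sat Ff fZ.
have eqC : 'C_S(<[x]>)%G = 'C_S[x]%G by apply: val_inj; rewrite /= cent_cycle.
by exists g; rewrite -?eqC // Eg ?cycle_id.
Qed.

Lemma central_Fconj p x z : saturated F p -> x \in 'Z(S) -> z \in 'Z(S) ->
  Fconj x z -> exists2 g, g \in F S S & g x = z.
Proof.
move=> sat /centerP[Sx cx] Zz cxz; have [g Fg Ex] := Fconj_extend sat cxz Zz.
have EC : 'C_S[x]%G = S.
  apply/val_inj/setIidPl/subsetP=> y Sy; by apply/cent1P/esym/cx.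
by exists g; rewrite -?[X in F X _]EC.
Qed.

(** * Squares are central *)

Section TwoGroup.
Hypotheses (S2 : 2.-group S) (sat : saturated F 2).
Hypothesis homZ : forall x, x \in S -> F <[x]>%G 'Z(S)%G != set0.

Lemma Fconj_center x : x \in S -> exists2 z, z \in 'Z(S) & Fconj x z.
Proof.
move=> /homZ/set0Pn[f Ff]; have [_ fZ _ _ _] := F_morphism Ff.
exists (f x); first by rewrite fZ ?cycle_id.
by apply/FconjP; exists <[x]>%G, 'Z(S)%G, f; rewrite cycle_id.
Qed.

(** [u] is conjugate to a generator of a central, fully automized subgroup [Q].
    Centrality gives Aut_S(Q) = 1, so Aut_F(Q) has odd order and cannot contain
    the inversion that [t] induces unless that inversion is trivial. *)
Lemma conj_inverse_eq u t : u \in S -> t \in S -> u ^ t = u^-1 -> u^-1 = u.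
Proof.
move=> Su St Eut; have /homZ/set0Pn[f Ff] := Su.
have [I [EI [f' isoI]]] := F_image Ff.
have [FfI _ _ _] := cat_isoP isoI.
have [_ fZ _ _ [su _ _]] := F_morphism Ff.
have sIZ : I \subset 'Z(S).
  by rewrite EI; apply/subsetP=> _ /imsetP[x Px ->]; apply: fZ.
have sI := subset_trans sIZ (center_sub S).
have [Q [r [Fr cQ fa rec]]] := saturatedP sat sI.
have [s Fs Es] := receptive_extend_central rec Fr (eq_leq cQ) sIZ.
have [_ _ _ _ [_ sQ _]] := F_morphism Fr.
have [r' /cat_isoP[_ Fr' _ r'K]] := F_iso Fr (eq_leq cQ).
have [_ r'I _ _ _] := F_morphism Fr'.
have sQZ : Q \subset 'Z(S).
  apply/subsetP=> x Qx; rewrite -(r'K x) // -Es ?r'I //.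
  by rewrite F_center // (subsetP sIZ) ?r'I.
have [h Fh] : exists h, h \in F <[u]>%G Q.
  by exists (compmap r f); apply: HomF_comp FfI Fr.
have [_ hQ hI _ _] := F_morphism Fh.
have leQu : #|Q| <= #|<[u]>%G|.
  by rewrite cQ EI leq_imset_card.
have [h' /cat_isoP[_ Fh' hK _]] := F_iso Fh leQu.
have Ft : conjmap <[u]>%G t \in F <[u]>%G <[u]>%G.
  by rewrite F_conj // -cycleJ Eut cycleV.
have [b Ab Eb] := perm_of_F (HomF_comp (HomF_comp Fh' Ft) Fh).
have uu := cycle_id u.
have Ebh : b (h u) = (h u)^-1.
  by rewrite Eb ?hQ // compmapE compmapE hK // ffunE uu Eut (F_V Fh).
have AutS1 : AutS S Q = 1.
  apply/trivgP/subsetP=> c /AutSP[Ac [a [Sa _ Ea]]]; rewrite inE; apply/eqP/permP=> x.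
  rewrite perm1; have [Qx | /out_Aut->//] := boolP (x \in Q).
  rewrite Ea //; have /(subsetP sQZ)/centerP[_ cx] := Qx.
  by rewrite conjgE cx // mulKg.
have oddA : odd #|AutF_group sQ|.
  have /and3P[_ _] := (fa : 2.-Sylow(AutF_group sQ) (AutS_group Q)).
  by rewrite /= AutS1 (indexg1 (AutF_group sQ)) odd_2'nat.
have oddb : odd #[b].
  by apply: dvdn_odd oddA; apply: (@order_dvdG _ (AutF_group sQ)).
have [Aa _ _] := AutFP Ab.
(* An odd power of [b] is the identity, but it inverts [h u] as [b] does. *)
have bb k : (b ^+ k.*2) (h u) = h u.
  elim: k => [|k IHk]; first by rewrite perm1.
  rewrite doubleS !expgSr !permM IHk Ebh -(autmE Aa) morphV ?hQ //.
  by rewrite /= autmE Ebh invgK.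
apply: hI; rewrite ?groupV // (F_V Fh) // -Ebh.
have := congr1 (fun c : {perm gT} => c (h u)) (expg_order b).
by rewrite /= -(odd_double_half #[b]) oddb add1n expgSr permM bb perm1.
Qed.

Lemma last_power_notin (Q N : {group gT}) : 2.-group N -> ~~ (N \subset Q) ->
  exists2 t, t \in N :\: Q & t ^+ 2 \in Q.
Proof.
move=> N2 /subsetPn[t Nt nQt].
have ex : exists n, t ^+ (2 ^ n) \in Q.
  have /p_natP[n En] := mem_p_elt N2 Nt; exists n.
  by rewrite -En expg_order group1.
case: (ex_minnP ex) => [[|n] Qn min_n]; first by rewrite expg1 (negPf nQt) in Qn.
exists (t ^+ (2 ^ n)); last by rewrite -expgM -expnSr.
apply/setDP; split; first exact: groupX.
by apply/negP=> /min_n; rewrite ltnn.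
Qed.

(** In the abelian group ['Z(Q)], the element [t] acts with [t ^+ 2] trivial and
    hence inverts [u := v^-1 * v ^ t]. So [u] is its own inverse, that is,
    [v ^+ 2] and its conjugate by [t] agree. *)
Lemma sqr_centralised (Q : {group gT}) t v : t \in 'N_S(Q) -> t ^+ 2 \in Q ->
  Q \subset S -> v \in 'Z(Q) -> commute (v ^+ 2) t.
Proof.
move=> /setIP[St Nt] Qt2 sQ Zv.
have Zvt : v ^ t \in 'Z(Q).
  by rewrite memJ_norm // (subsetP (char_norms (center_char Q))).
have abZ := center_abelian Q.
have cvvt : commute v (v ^ t) by apply: (centsP abZ).
have vt2 : (v ^ t) ^ t = v.
  by rewrite -conjgM -expg2 /conjg; have /centerP[_ ->] := Zv; rewrite ?mulKg.
have Su : v^-1 * v ^ t \in S.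
  by rewrite (subsetP sQ) // (subsetP (center_sub Q)) // groupM ?groupV.
have Eu : (v^-1 * v ^ t)^-1 = (v ^ t)^-1 * v by rewrite [LHS]invMg invgK.
have E : (v ^ t)^-1 * v = v^-1 * v ^ t.
  by rewrite -Eu; apply: conj_inverse_eq Su St _; rewrite Eu conjMg conjVg vt2.
apply/commgP/conjg_fixP; rewrite conjXg !expgS !expg0 !mulg1.
transitivity (v * (v ^ t * (v^-1 * v ^ t))); last by rewrite -E mulKVg.
by rewrite [RHS]mulgA cvvt -[RHS]mulgA mulKVg.
Qed.

(** Among the noncentral conjugates of [z ^+ 2] take one with largest
    centraliser. Its image [y] in a fully normalised copy [Q] of the centraliser
    is still noncentral, because the morphism to [Q] is defined on the strictly
    larger normaliser; by maximality [Q] is exactly the centraliser of [y].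
    Extending the inverse of a morphism that sends [y] to [z ^+ 2] so that it is
    defined at [z] yields a square root of [y] in ['Z(Q)], against
    [sqr_centralised]. *)
Lemma Fconj_sqr_central w z : z \in 'Z(S) -> Fconj w (z ^+ 2) -> w \in 'Z(S).
Proof.
move=> Zz cwz; apply: contraT => nZw.
pose bad x := (x \notin 'Z(S)) && Fconj x (z ^+ 2).
have bad_w : bad w by rewrite /bad nZw.
have Zz2 : z ^+ 2 \in 'Z(S) by rewrite groupX.
case: (@arg_maxnP _ w bad (fun x => #|'C_S[x]|) bad_w) => x /andP[nZx cxz] max_x.
have Sx := Fconj_in cxz.
have [Q [g [rec cQ Fg EQ]]] := fully_normalized S2 sat (subsetIl S 'C[x]).
have centN_gt (A : {group gT}) y :
  A = 'C_S[y] :> {set gT} -> y \in S -> y \notin 'Z(S) ->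
  ~~ ('N_S(A) \subset A).
  move=> EA Sy nZy; have sAS : A \proper S.
    rewrite properE EA subsetIl subsetI subxx sub_cent1 /=.
    by apply: contra nZy => Cy; rewrite inE Sy.
  have := nilpotent_proper_norm (pgroup_nil S2) sAS.
  by rewrite properE subsetI => /andP[_].
have [gM gS gI _ [sN _ _]] := F_morphism Fg.
have sCN : 'C_S[x] \subset 'N_S('C_S[x]) by rewrite subsetI subsetIl normG.
have Cx : x \in 'C_S[x] by rewrite inE Sx cent1id.
have Nx := subsetP sCN x Cx.
have nZy : g x \notin 'Z(S).
  have /subsetPn[t Nt nCt] := centN_gt 'C_S[x]%G x (erefl _) Sx nZx.
  apply: contra nCt => /centerP[_ cgx].
  rewrite inE (subsetP sN) //; apply/cent1P/esym; apply: gI; rewrite ?groupM //.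
  by rewrite !gM // cgx ?gS.
have cyz : Fconj (g x) (z ^+ 2).
  apply: Fconj_trans cxz; apply: Fconj_sym; apply/FconjP.
  by exists 'N_S('C_S[x])%G, S, g.
have Sy := Fconj_in cyz; set y := g x in nZy cyz Sy.
have EQy : Q = 'C_S[y]%G.
  apply/val_inj/eqP; rewrite /= eqEcard; apply/andP; split; last first.
    by rewrite [X in _ <= X]cQ; apply: max_x; rewrite /bad nZy.
  rewrite -EQ; apply/subsetP=> _ /imsetP[c Cc ->].
  have Nc := subsetP sCN c Cc.
  rewrite inE gS //; apply/cent1P; rewrite /y /commute -!gM //.
  by congr (g _); case/setIP: Cc => _ /cent1P.
have memQ a : (a \in Q) = (a \in 'C_S[y]) by rewrite EQy.
have sQ : Q \subset S by rewrite EQy subsetIl.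
(* [k] maps [Q] to [P1] and [y] to [z ^+ 2]; [m] extends its inverse. *)
have [k Fk Ek] := Fconj_extend sat cyz Zz2; rewrite -EQy in Fk.
have [kM kS kI _ _] := F_morphism Fk.
have [P1 [EP1 [k' /cat_isoP[FkP Fk' kK k'K]]]] := F_image Fk.
have cP1 : #|P1| = #|Q| by rewrite EP1 card_in_imset.
have [N [m [Fm Em sPN Nm]]] := receptive_extend rec Fk' (eq_leq (esym cP1)).
have [_ k'Q _ _ [sP1 _ _]] := F_morphism Fk'.
have [mM mS mI _ _] := F_morphism Fm.
have /centerP[Sz cz] := Zz.
have czP a : a \in P1 -> a ^ z = a.
  by move=> Pa; rewrite conjgE -cz ?(subsetP sP1) // mulKg.
have Nz : z \in N.
  apply: (Nm z 1) => //; last by move=> a Pa; rewrite czP // conjg1.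
  rewrite inE Sz inE; apply/subsetP=> _ /imsetP[a Pa ->].
  by rewrite czP.
have Qy : y \in Q by rewrite EQy inE Sy cent1id.
have Ev : (m z) ^+ 2 = y.
  by rewrite -(F_X _ Fm) // Em -?Ek ?kK // EP1 imset_f.
have cQv q : q \in Q -> commute (m z) q.
  move=> Qq; have Pkq : k q \in P1 by rewrite EP1 imset_f.
  have Nkq := subsetP sPN _ Pkq.
  rewrite -(kK q) // -Em // /commute -!mM //.
  by rewrite cz // (subsetP sP1).
have Zv : m z \in 'Z(Q).
  apply/centerP; split; last exact: cQv.
  rewrite memQ inE mS //.
  by apply/cent1P; apply: cQv.
have nNQ : ~~ ('N_S(Q) \subset Q) by apply: (centN_gt Q y) => //; rewrite EQy.
have [t] := last_power_notin (pgroupS (subsetIl S _) S2) nNQ.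
case/setDP=> Nt nQt Qt2; case/negP: nQt.
rewrite memQ inE; case/setIP: (Nt) => -> _ /=; apply/cent1P/esym.
by rewrite -Ev; apply: sqr_centralised Zv.
Qed.

(** * The group of squares of central elements *)

Definition sqZ := [set z ^+ 2 | z in 'Z(S)].

Lemma mem_sqZ z : z \in 'Z(S) -> z ^+ 2 \in sqZ.
Proof. exact: (imset_f (fun z => z ^+ 2)). Qed.

Lemma sqZ_group_set : group_set sqZ.
Proof.
apply/group_setP; split.
  by apply/imsetP; exists 1; rewrite ?expg1n ?group1.
move=> _ _ /imsetP[a Za ->] /imsetP[b Zb ->]; rewrite -expgMn.
  by rewrite mem_sqZ ?groupM.
by have := center_abelian S; move/centsP; apply.
Qed.
Canonical sqZ_group := Group sqZ_group_set.

Lemma sqZ_sub : sqZ \subset 'Z(S).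
Proof. by apply/subsetP=> _ /imsetP[z Zz ->]; rewrite groupX. Qed.

(** Once [w] is known to be central, its conjugacy with [y] is realised by an
    automorphism of [S], which preserves the squares of ['Z(S)]. *)
Lemma sqZ_Fconj w y : y \in sqZ -> Fconj w y -> w \in sqZ.
Proof.
case/imsetP=> z Zz -> cwz; have Zw := Fconj_sqr_central Zz cwz.
have [g Fg Ew] := central_Fconj sat Zw (groupX 2 Zz) cwz.
have [g' /cat_isoP[_ Fg' gK _]] := F_iso Fg (leqnn _).
have Sz := subsetP (center_sub S) z Zz.
rewrite -(gK w) ?(subsetP (center_sub S)) // Ew (F_X _ Fg') //.
by rewrite mem_sqZ ?F_center.
Qed.

Lemma F_sqZ P Q f y : f \in F P Q -> y \in P -> (f y \in sqZ) = (y \in sqZ).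
Proof.
move=> Ff Py; have cyf : Fconj y (f y) by apply/FconjP; exists P, Q, f.
by apply/idP/idP=> /sqZ_Fconj; apply=> //; apply: Fconj_sym.
Qed.

Lemma F_imset_sqZ P Q f : f \in F P Q -> sqZ \subset P -> f @: sqZ = sqZ.
Proof.
move=> Ff sYP; have [_ _ fI _ _] := F_morphism Ff.
apply/eqP; rewrite eqEcard (card_in_imset (sub_in2 (subsetP sYP) fI)) leqnn andbT.
by apply/subsetP=> _ /imsetP[y Yy ->]; rewrite (F_sqZ Ff) // (subsetP sYP).
Qed.

Lemma sqr_sqZ x : x \in S -> x ^+ 2 \in sqZ.
Proof.
case/Fconj_center=> z Zz /exists_inP[f Ff /eqP Ez].
by rewrite -(F_sqZ Ff) ?mem_cycle // (F_X _ Ff) ?cycle_id // Ez mem_sqZ.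
Qed.

Lemma comm_sqZ a b : a \in S -> b \in S -> [~ a, b] \in sqZ.
Proof.
move=> Sa Sb; have -> : [~ a, b] = (a^-1) ^+ 2 * (a * b^-1) ^+ 2 * b ^+ 2.
  by rewrite commgEl conjgE !expgS !expg0 !mulg1 !mulgA !mulgKV.
by apply: groupM; [apply: groupM|]; apply: sqr_sqZ; rewrite ?groupM ?groupV.
Qed.

(** * Extension to the whole group *)

(** The stabiliser in Aut_F(Q) of the series 1 <= [sqZ] <= [Q]. *)
Definition stab_sqZ Q : {set {perm gT}} :=
  [set b in AutF F Q | [forall x in Q, x^-1 * b x \in sqZ]
                       && [forall y in sqZ, b y == y]].

Lemma stab_sqZP Q b :
  reflect [/\ b \in AutF F Q, {in Q, forall x, x^-1 * b x \in sqZ}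
            & {in sqZ, forall y, b y = y}] (b \in stab_sqZ Q).
Proof.
apply: (iffP setIdP) => [[Ab /andP[/forall_inP Kb /forall_inP Yb]] | [Ab Kb Yb]].
  by split=> // y /Yb/eqP.
by split=> //; apply/andP; split; apply/forall_inP=> // y /Yb/eqP.
Qed.

Lemma stab_sqZ_group_set Q : Q \subset S -> group_set (stab_sqZ Q).
Proof.
move=> sQ; apply/group_setP; split.
  apply/stab_sqZP; split; first exact: (group1 (AutF_group sQ)).
    by move=> x _; rewrite perm1 mulVg group1.
  by move=> y _; rewrite perm1.
move=> b c /stab_sqZP[Ab Kb Yb] /stab_sqZP[Ac Kc Yc]; apply/stab_sqZP; split.
- exact: (@groupM _ (AutF_group sQ)).
- move=> x Qx; have [_ _ bQ] := AutFP Ab.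
  by rewrite permM -(mulKVg (b x) (c _)) mulgA groupM ?Kb ?Kc ?bQ.
by move=> y Yy; rewrite permM Yb // Yc.
Qed.

(** As [b] fixes [x^-1 * b x], the powers of [b] multiply [x] by the powers of
    that element, so the order of [b] divides that of [S]. *)
Lemma stab_sqZ_pgroup Q (sQ : Q \subset S) : sqZ \subset Q ->
  2.-group (Group (stab_sqZ_group_set sQ)).
Proof.
move=> sYQ; apply: pgroup_of_elts => b /stab_sqZP[/AutFP[Ab _ bQ] Kb Yb].
have bM : {in Q &, {morph b : x y / x * y}}.
  by move=> x y Qx Qy; rewrite -(autmE Ab) morphM.
have bX n : {in Q, forall x, (b ^+ n) x = x * (x^-1 * b x) ^+ n}.
  move=> x Qx; have Yk := Kb x Qx.
  elim: n => [|n IHn]; first by rewrite perm1 mulg1.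
  have Ykn := groupX n Yk.
  rewrite expgSr permM IHn bM // ?(Yb _ Ykn) ?(subsetP sYQ _ Ykn) //.
  by rewrite [in RHS]expgS mulgA mulKVg.
apply: (@pnat_dvd _ #|S|) S2; rewrite order_dvdn; apply/eqP/permP=> x.
rewrite perm1; have [Qx | nQx] := boolP (x \in Q); last first.
  by rewrite (out_Aut (groupX _ Ab)).
rewrite bX // (_ : _ ^+ #|S| = 1) ?mulg1 //; apply: expg_cardG.
by rewrite groupM ?groupV ?(subsetP sQ) ?bQ.
Qed.

(** Since [sqZ] is closed under conjugacy, its stabiliser is normal in Aut_F(Q);
    a normal 2-subgroup lies in every Sylow 2-subgroup, hence in Aut_S(Q). *)
Lemma stab_sqZ_sub_AutS Q : sqZ \subset Q -> Q \subset S ->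
  fully_automized F 2 Q -> stab_sqZ Q \subset AutS S Q.
Proof.
move=> sYQ sQ fa; pose A := AutF_group sQ; pose K := Group (stab_sqZ_group_set sQ).
have sKA : K \subset A by apply/subsetP=> b /stab_sqZP[].
have pK := stab_sqZ_pgroup sQ sYQ.
have [b Ab sKb] := Sylow_subJ (fa : 2.-Sylow(A) (AutS_group Q)) sKA pK.
suff nKA : A \subset 'N(K) by rewrite -(conjSg _ _ b) (normsP nKA b Ab : K :^ b = K).
apply/subsetP=> c Ac; rewrite inE; apply/subsetP=> _ /imsetP[d Kd ->].
have [Ad Kdx Yd] := stab_sqZP _ _ Kd.
have Ac' : c^-1 \in A by rewrite groupV.
have [AAc Fc cQ] := AutFP Ac; have [AAc' Fc' c'Q] := AutFP Ac'.
apply/stab_sqZP; split; first exact: (@groupJ _ A).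
  move=> x Qx; rewrite conjgE !permM; set u := c^-1 x.
  have Qu : u \in Q by apply: c'Q.
  have -> : x = c u by rewrite permKV.
  have [_ _ dQ] := AutFP Ad.
  have -> : (c u)^-1 * c (d u) = resmap Q c (u^-1 * d u).
    rewrite ffunE groupM ?groupV ?dQ // -(autmE AAc).
    by rewrite morphM ?morphV ?groupV ?dQ.
  by rewrite (F_sqZ Fc) ?Kdx // groupM ?groupV ?dQ.
move=> y Yy; have Qy := subsetP sYQ y Yy.
have Yy' : c^-1 y \in sqZ.
  by have := F_sqZ Fc' Qy; rewrite ffunE Qy Yy.
by rewrite conjgE !permM Yd // permKV.
Qed.

(** Conjugation by [S] stabilises 1 <= [sqZ] <= [P1], and [r] carries this
    series to 1 <= [sqZ] <= [Q]. *)
Lemma sqZ_extend_receptive P1 Q r : sqZ \subset P1 -> r \in F P1 Q ->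
    #|Q| = #|P1| -> fully_automized F 2 Q -> receptive F Q ->
  exists2 g, g \in F S S & {in P1, g =1 r}.
Proof.
move=> sYP Fr cQ fa rec; have [rM rQ rI _ [sP1 sQ _]] := F_morphism Fr.
have leQP := eq_leq cQ.
have EQ : r @: P1 = Q.
  apply/eqP; rewrite eqEcard card_in_imset // cQ leqnn andbT.
  by apply/subsetP=> _ /imsetP[x Px ->]; apply: rQ.
have sYQ : sqZ \subset Q by rewrite -(F_imset_sqZ Fr sYP) -EQ imsetS.
have sTK : transported_AutS P1 Q r \subset stab_sqZ Q.
  apply/subsetP=> b /transported_AutSP[Ab [a /setIP[Sa Na] Ea]].
  apply/stab_sqZP; split=> //.
    move=> x; rewrite -EQ => /imsetP[u Pu ->].
    have Pua : [~ u, a] \in P1 by rewrite commgEl groupM ?groupV ?memJ_norm.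
    rewrite -Ea // -(F_V Fr) // -rM ?groupV ?memJ_norm // -commgEl.
    by rewrite (F_sqZ Fr) // comm_sqZ // (subsetP sP1).
  move=> y Yy; have /imsetP[u Pu Ey] : y \in r @: P1 by rewrite EQ (subsetP sYQ).
  have Yu : u \in sqZ by rewrite -(F_sqZ Fr Pu) -Ey.
  have /(subsetP sqZ_sub)/centerP[_ cu] := Yu.
  by rewrite Ey -Ea // conjgE cu // mulKg.
have sTS := subset_trans sTK (stab_sqZ_sub_AutS sYQ sQ fa).
have [g Fg Eg] := extend_normalizer rec Fr leQP sTS.
exists g => //; suff EN : 'N_S(P1)%G = S by rewrite -[X in F X _]EN.
apply/val_inj/setIidPl/subsetP=> a Sa; rewrite inE.
apply/subsetP=> _ /imsetP[x Px ->]; rewrite conjg_mulR groupM //.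
by rewrite (subsetP sYP) // comm_sqZ // (subsetP sP1).
Qed.

Lemma sqZ_extend P f : sqZ \subset P -> f \in F P S ->
  exists2 g, g \in F S S & {in P, g =1 f}.
Proof.
move=> sYP Ff; have [I [EI [f' iso]]] := F_image Ff.
have [FfI _ _ _] := cat_isoP iso; have [_ _ fI _ [_ sI _]] := F_morphism FfI.
have [Q [r [Fr cQ fa rec]]] := saturatedP sat sI.
have cI : #|I| = #|P| by rewrite EI card_in_imset.
have [g Fg Eg] : exists2 g, g \in F S S & {in P, g =1 compmap r f}.
  by apply: sqZ_extend_receptive (HomF_comp FfI Fr) _ fa rec; rewrite ?cQ.
have sYI : sqZ \subset I by rewrite -(F_imset_sqZ Ff sYP) EI imsetS.
have [s Fs Es] := sqZ_extend_receptive sYI Fr cQ fa rec.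
have FrS : r \in F I S.
  have [_ rQ _ _ [_ sQ _]] := F_morphism Fr.
  by apply: F_corestrict Fr _ _ => // x Ix; rewrite (subsetP sQ) ?rQ.
apply: (extend_back FfI FrS Fs Es Fg) => x Px.
by rewrite Eg // compmapE.
Qed.

End TwoGroup.
End FusionSystems.

Theorem theorem1 (gT : finGroupType) (S : {group gT}) (F : fusion_system S)
  (S2 : 2.-group S) (satF : saturated F 2)
  (homZ : forall x : gT, x \in S -> F <[x]>%G 'Z(S)%G != set0) :
  abelian S.
Proof.
suff sSZ : S \subset 'Z(S) by apply: abelianS sSZ (center_abelian S).
apply/subsetP=> x Sx; have [z Zz cxz] := Fconj_center homZ Sx.
have [f Ff Ez] := Fconj_extend satF cxz Zz.
have sYC : sqZ S \subset 'C_S[x].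
  apply/subsetP=> y /(subsetP (sqZ_sub S))/centerP[Sy cy].
  by rewrite inE Sy; apply/cent1P/cy.
have [g Fg Eg] := sqZ_extend S2 satF homZ sYC Ff.
have [g' /cat_isoP[_ Fg' gK _]] := F_iso Fg (leqnn _).
have Cx : x \in 'C_S[x] by rewrite inE Sx cent1id.
by rewrite -(gK x) // Eg // Ez (F_center Fg').
Qed.
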